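(* Let $A \in \mathbb{M}_{m,n}$ and $B \in \mathbb{M}_{n,m}$. The following statements are equivalent: (i) $\det(I + e^{j\theta} AB) \neq 0$ for all $\theta \in [0, 2\pi)$; (ii) there exist $N \in \mathbb{H}_n$ and $M \in \mathbb{H}_m$ such that $$P = \begin{bmatrix} -N & 0 \\ 0 & M \end{bmatrix} \in \mathbb{H}_{n+m}$$ satisfies $$\begin{bmatrix} I & -A^* \end{bmatrix} P \begin{bmatrix} I \\ -A \end{bmatrix} \prec 0 \quad\text{and}\quad \begin{bmatrix} B^* & I \end{bmatrix} P \begin{bmatrix} B \\ I \end{bmatrix} \succ 0;$$ (iii) $\lambda(AB) \cap \mathbb{T} = \emptyset$; (iv) there exist $M \in \mathbb{H}_m$ and $N \in \mathbb{H}_n$ such that $A^*MA \prec N$ and $B^*NB \prec M$.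
   Context: $\mathbb{M}_{m,n}$: complex $m\times n$ matrices; $\mathbb{H}_n$: Hermitian $n\times n$ matrices; $\cdot^*$: conjugate transpose; $\prec,\succ$: (strict) Loewner order; $\lambda(\cdot)$: set of eigenvalues; $\mathbb{T} = \{z\in\mathbb{C} : |z|=1\}$; $j^2=-1$. *)

(* Defs.v *)
(* MathComp-Analysis: the reals are an arbitrary R : realType and the complex
   numbers are R[i] from mathcomp-real-closed. *)
From mathcomp Require Import all_boot all_order all_algebra.
From mathcomp Require Import all_classical all_reals all_analysis.
From mathcomp Require Export complex.

Set Implicit Arguments.
Unset Strict Implicit.
Unset Printing Implicit Defensive.

Import Order.TTheory GRing.Theory Num.Theory.
Local Open Scope classical_set_scope.
Local Open Scope sesquilinear_scope.
Local Open Scope complex_scope.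
Local Open Scope ring_scope.

(* e^z = e^(Re z) (cos (Im z) + i sin (Im z)). *)
Definition cexp (R : realType) (z : R[i]) : R[i] :=
  (expR (complex.Re z))%:C * (cos (complex.Im z) +i* sin (complex.Im z)).

(* On R[i], 0 < w means that w is real and positive. *)
Definition posdefmx (R : realType) (n : nat) (X : 'M[R[i]]_n) : Prop :=
  X \is hermsymmx /\
  forall v : 'cV[R[i]]_n, v != 0 -> 0 < (v ^t* *m X *m v) 0 0.

Definition loewner_lt (R : realType) (n : nat) (X Y : 'M[R[i]]_n) : Prop :=
  posdefmx (Y - X).

Notation "X \prec Y" := (loewner_lt X Y)
  (at level 70, no associativity) : ring_scope.
Notation "X \succ Y" := (loewner_lt Y X)
  (at level 70, no associativity, only parsing) : ring_scope.

(* [eigenvalue] is defined through row vectors (v *m X = z *: v); for a square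
   matrix over a field this gives the same set as column vectors. *)
Definition spectrum (R : realType) (n : nat) (X : 'M[R[i]]_n) : set R[i] :=
  [set z | eigenvalue X z].

Definition unit_circle (R : realType) : set R[i] := [set z | `|z| = 1].
Arguments unit_circle R : clear implicits.

(* Main.v *)
Require Import Defs.
From mathcomp Require Import all_boot all_order all_algebra.
From mathcomp Require Import all_classical all_reals all_analysis.
From mathcomp Require Import ring.

Set Implicit Arguments.
Unset Strict Implicit.
Unset Printing Implicit Defensive.

Import Order.TTheory GRing.Theory Num.Theory.
Local Open Scope classical_set_scope.
Local Open Scope sesquilinear_scope.
Local Open Scope complex_scope.
Local Open Scope ring_scope.

(** Write C = AB.  All four conditions say that no eigenvalue of C lies on the
    unit circle.

    For (i) this is a parametrization of the circle: det (1 + wC) vanishes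
    exactly when - 1/w is an eigenvalue of C, and every w of modulus 1 is
    e^(i theta) for some theta in [0, 2 pi[ (det_cexp_spectrum).  Conditions
    (ii) and (iv) are the same inequalities once the block products are
    expanded (block_forms).

    (iv) excludes unimodular eigenvalues: if ABv = zv with |z| = 1, test the
    first inequality on Bv and the second on v.  Since A(Bv) = zv has the same
    M-form as v, the two give v*Mv < (Bv)*N(Bv) < v*Mv (spectrum_of_loewner).

    Conversely, it suffices to solve the strict Stein inequality
    M - C*MC > B*B, for then N = A*MA + 1 works: B*NB = C*MC + B*B
    (loewner_of_spectrum).  The Stein inequality is solvable with any Hermitian
    right-hand side as soon as C has no unimodular eigenvalue: Schur
    triangularization reduces it to triangular C (stein_ineq), and there a
    block diagonal solution is built one diagonal entry at a time
    (stein_trig). *)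

(** * Conjugate transposes and Hermitian matrices *)

Lemma trmxC_mul (C : numClosedFieldType) (m n p : nat)
    (X : 'M[C]_(m, n)) (Y : 'M[C]_(n, p)) :
  (X *m Y) ^t* = Y ^t* *m X ^t*.
Proof. by rewrite trmx_mul map_mxM. Qed.

Lemma trmxC_add (C : numClosedFieldType) (m n : nat) (X Y : 'M[C]_(m, n)) :
  (X + Y) ^t* = X ^t* + Y ^t*.
Proof. by rewrite linearD map_mxD. Qed.

Lemma trmxC_opp (C : numClosedFieldType) (m n : nat) (X : 'M[C]_(m, n)) :
  (- X) ^t* = - X ^t*.
Proof. by rewrite linearN map_mxN. Qed.

Lemma trmxC_scale (C : numClosedFieldType) (m n : nat) (a : C)
    (X : 'M[C]_(m, n)) :
  (a *: X) ^t* = a^* *: X ^t*.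
Proof. by rewrite linearZ map_mxZ. Qed.

Lemma trmxC_scalar (C : numClosedFieldType) (n : nat) (a : C) :
  (a%:M : 'M[C]_n) ^t* = (a^*)%:M.
Proof. by rewrite tr_scalar_mx map_scalar_mx. Qed.

Lemma trmxC_zero (C : numClosedFieldType) (m n : nat) :
  (0 : 'M[C]_(m, n)) ^t* = 0.
Proof. by rewrite trmx0 map_mx0. Qed.

Lemma trmxC_block (C : numClosedFieldType) (m1 m2 n1 n2 : nat)
    (X : 'M[C]_(m1, n1)) (Y : 'M[C]_(m1, n2))
    (Z : 'M[C]_(m2, n1)) (W : 'M[C]_(m2, n2)) :
  (block_mx X Y Z W) ^t* = block_mx (X ^t* ) (Z ^t* ) (Y ^t* ) (W ^t* ).
Proof. by rewrite tr_block_mx map_block_mx. Qed.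

Lemma trmxC_col (C : numClosedFieldType) (m1 m2 n : nat)
    (X : 'M[C]_(m1, n)) (Y : 'M[C]_(m2, n)) :
  (col_mx X Y) ^t* = row_mx (X ^t* ) (Y ^t* ).
Proof. by rewrite tr_col_mx map_row_mx. Qed.

Lemma trmxC_row (C : numClosedFieldType) (m n1 n2 : nat)
    (X : 'M[C]_(m, n1)) (Y : 'M[C]_(m, n2)) :
  (row_mx X Y) ^t* = col_mx (X ^t* ) (Y ^t* ).
Proof. by rewrite tr_row_mx map_col_mx. Qed.

Lemma hermsymmxP (C : numClosedFieldType) (n : nat) (X : 'M[C]_n) :
  reflect (X ^t* = X) (X \is hermsymmx).
Proof.
by apply: (iffP (is_hermitianmxP _ _ _)); rewrite expr0 scale1r => /esym.
Qed.

Lemma hermsymmx_add (C : numClosedFieldType) (n : nat) (X Y : 'M[C]_n) :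
  X \is hermsymmx -> Y \is hermsymmx -> X + Y \is hermsymmx.
Proof.
by move=> /hermsymmxP hX /hermsymmxP hY; apply/hermsymmxP;
  rewrite trmxC_add hX hY.
Qed.

Lemma hermsymmx_opp (C : numClosedFieldType) (n : nat) (X : 'M[C]_n) :
  X \is hermsymmx -> - X \is hermsymmx.
Proof. by move=> /hermsymmxP hX; apply/hermsymmxP; rewrite trmxC_opp hX. Qed.

Lemma hermsymmx_congr (C : numClosedFieldType) (m n : nat) (X : 'M[C]_m)
    (D : 'M[C]_(m, n)) :
  X \is hermsymmx -> D ^t* *m X *m D \is hermsymmx.
Proof.
by move=> /hermsymmxP hX; apply/hermsymmxP; rewrite !trmxC_mul trmxCK hX mulmxA.
Qed.

Lemma hermsymmx_gram (C : numClosedFieldType) (m n : nat) (D : 'M[C]_(m, n)) :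
  D ^t* *m D \is hermsymmx.
Proof. by apply/hermsymmxP; rewrite trmxC_mul trmxCK. Qed.

Lemma hermsymmx_block (C : numClosedFieldType) (m n : nat)
    (X : 'M[C]_m) (Y : 'M[C]_n) :
  X \is hermsymmx -> Y \is hermsymmx -> block_mx X 0 0 Y \is hermsymmx.
Proof.
by move=> /hermsymmxP hX /hermsymmxP hY; apply/hermsymmxP;
  rewrite trmxC_block !trmxC_zero hX hY.
Qed.

Lemma hermsymmx_blockP (C : numClosedFieldType) (m n : nat)
    (X : 'M[C]_(m + n)) : X \is hermsymmx ->
  [/\ ulsubmx X \is hermsymmx, ursubmx X = (dlsubmx X) ^t* &
      drsubmx X \is hermsymmx].
Proof.
move=> /hermsymmxP; rewrite -{1 2}[X]submxK trmxC_block => /eq_block_mx.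
by case=> hul <- _ hdr; split=> //; exact/hermsymmxP.
Qed.

(** * Positive definite matrices *)

Lemma gram_ge0 (C : numClosedFieldType) (n : nat) (v : 'cV[C]_n) :
  0 <= (v ^t* *m v) 0 0.
Proof.
by rewrite mxE sumr_ge0 // => i _; rewrite !mxE mulrC mul_conjC_ge0.
Qed.

Lemma posdefmx1 (R : realType) (n : nat) : posdefmx (1%:M : 'M[R[i]]_n).
Proof.
split; first exact: hermitian1mx_subproof.
move=> v /cV0Pn [i vi]; rewrite mulmx1 mxE (bigD1 i) //= ltr_wpDr //.
  by rewrite sumr_ge0 // => j _; rewrite !mxE mulrC mul_conjC_ge0.
by rewrite !mxE mulrC mul_conjC_gt0.
Qed.

Lemma posdefmx_ge0 (R : realType) (n : nat) (X : 'M[R[i]]_n) (v : 'cV_n) :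
  posdefmx X -> 0 <= (v ^t* *m X *m v) 0 0.
Proof.
case=> _ hX; have [->|/hX/ltW//] := eqVneq v 0.
by rewrite mulmx0 mxE.
Qed.

Lemma posdefmx_add_gram (R : realType) (m n : nat) (X : 'M[R[i]]_n)
    (D : 'M[R[i]]_(m, n)) :
  posdefmx X -> posdefmx (X + D ^t* *m D).
Proof.
case=> hX pX; split; first exact: hermsymmx_add hX (hermsymmx_gram D).
move=> v /pX v_gt0; rewrite mulmxDr mulmxDl mxE ltr_wpDr //.
by rewrite mulmxA -mulmxA -trmxC_mul gram_ge0.
Qed.

Lemma posdefmx_congr (R : realType) (n : nat) (X D : 'M[R[i]]_n) :
  D \in unitmx -> posdefmx X -> posdefmx (D ^t* *m X *m D).
Proof.
move=> uD [hX pX]; split; first exact: hermsymmx_congr.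
move=> v v0; rewrite !mulmxA -trmxC_mul -mulmxA; apply: pX.
by apply: contra v0 => /eqP Dv0; rewrite -[v](mulKmx uD) Dv0 mulmx0.
Qed.

Lemma posdefmx_block (R : realType) (m n : nat)
    (X : 'M[R[i]]_m) (Y : 'M[R[i]]_n) :
  posdefmx X -> posdefmx Y -> posdefmx (block_mx X 0 0 Y).
Proof.
move=> pX pY; split; first exact: hermsymmx_block pX.1 pY.1.
move=> v; rewrite -[v]vsubmxK; set u := usubmx v; set w := dsubmx v => uw0.
rewrite trmxC_col mul_row_block !mulmx0 addr0 add0r mul_row_col mxE.
have [u0|u0] := eqVneq u 0; last first.
  by rewrite ltr_wpDr ?posdefmx_ge0 //; exact: pX.2.
rewrite ltr_wpDl ?posdefmx_ge0 //; apply: pY.2.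
by apply: contra uw0 => /eqP ->; rewrite u0 col_mx0.
Qed.

(** * The strict Stein inequality *)

(** Induction on the size, writing T = [a 0; c T'] and looking for
    M = [mu 0; 0 M'].  The induction hypothesis for Q' + 1, with Q' the lower
    right block of Q, gives M' such that X := M' - T'*M'T' - Q' satisfies
    X > 1.  The lower left block b of M - T*MT - Q then depends on M' only,
    while its upper left block is (1 - |a|^2) mu plus terms independent of mu.
    As |a| <> 1, mu can be chosen to make that block equal to 1 + b*b, and then
    M - T*MT - Q = [1 0; 0 X - 1] + [b 1]* [b 1] is positive definite. *)
Lemma stein_trig (R : realType) (n : nat) (T Q : 'M[R[i]]_n) :
  is_trig_mx T -> (forall i, `|T i i| != 1) -> Q \is hermsymmx ->
  exists2 M : 'M[R[i]]_n, M \is hermsymmx & Q \prec M - T ^t* *m M *m T.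
Proof.
elim: n T Q => [|n IHn] T Q trigT diagT hQ.
  exists 0; first by apply/hermsymmxP; rewrite trmxC_zero.
  split; first by apply/hermsymmxP; rewrite [LHS]flatmx0 [RHS]flatmx0.
  by move=> v; rewrite [v]flatmx0 eqxx.
rewrite -[n.+1]/(1 + n)%N in T Q trigT diagT hQ *.
have [hQul Qur hQdr] := hermsymmx_blockP hQ.
set a := T 0 0.
set c := dlsubmx T; set T' := drsubmx T.
have TE : T = block_mx a%:M 0 c T'.
  rewrite -[LHS]submxK (ursubmx_trig _ trigT) //; congr block_mx.
  by rewrite [LHS]mx11_scalar !mxE; congr ((T _ _)%:M); exact/val_inj.
have [|||M' hM' pM'] := IHn T' (drsubmx Q + 1%:M).
- exact: drsubmx_trig.
- by move=> i; rewrite /T' !mxE; exact: diagT.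
- exact: hermsymmx_add hQdr (hermitian1mx_subproof _).
set b := - (T' ^t* *m M' *m c) - dlsubmx Q.
(* S is the value that (1 - |a|^2) mu must take for the upper left block to be
   1 + b*b; as a 1 x 1 matrix it is Hermitian, hence so is mu. *)
pose S : 'M[R[i]]_1 := 1%:M + b ^t* *m b + c ^t* *m M' *m c + ulsubmx Q.
have hS : S \is hermsymmx.
  apply: hermsymmx_add hQul; apply: hermsymmx_add (hermsymmx_congr c hM').
  exact: hermsymmx_add (hermitian1mx_subproof _) (hermsymmx_gram b).
have da : 1 - a^* * a != 0.
  rewrite subr_eq0 eq_sym mulrC -normCK sqrp_eq1 //; exact: diagT.
pose mu : 'M[R[i]]_1 := (1 - a^* * a)^-1 *: S.
have hmu : mu \is hermsymmx.
  apply/hermsymmxP; rewrite trmxC_scale (hermsymmxP _ hS); congr (_ *: _).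
  by rewrite fmorphV rmorphB rmorph1 rmorphM /= conjCK mulrC.
have muE : mu - a^* *: (a *: mu) = S.
  by rewrite scalerA -{1}[mu]scale1r -scalerBl scalerA mulfV // scale1r.
have hM : block_mx mu 0 0 M' \is hermsymmx by exact: hermsymmx_block hmu hM'.
exists (block_mx mu 0 0 M'); first exact: hM.
rewrite /loewner_lt.
suff -> : block_mx mu 0 0 M' - T ^t* *m block_mx mu 0 0 M' *m T - Q =
    block_mx 1%:M 0 0 (M' - T' ^t* *m M' *m T' - (drsubmx Q + 1%:M)) +
    (row_mx b 1%:M) ^t* *m row_mx b 1%:M.
  by apply: posdefmx_add_gram; apply: posdefmx_block pM'; exact: posdefmx1.
have bC : b ^t* = - (c ^t* *m M' *m T') - (dlsubmx Q) ^t*.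
  rewrite /b trmxC_add !trmxC_opp !trmxC_mul trmxCK.
  by rewrite (hermsymmxP _ hM') mulmxA.
rewrite -[in LHS](submxK Q) Qur {1 2}TE trmxC_block trmxC_zero trmxC_scalar.
rewrite !mulmx_block !(mulmx0, mul0mx, addr0, add0r) trmxC_row mul_col_row.
rewrite trmxC_scalar conjC1 !(mulmx1, mul1mx) !opp_block_mx !add_block_mx.
rewrite !(add0r, addr0) !mul_scalar_mx mul_mx_scalar.
congr block_mx.
- have -> : a *: (a^* *: mu) = mu - S.
    by rewrite -muE opprB addrC subrK scalerA [a * _]mulrC -scalerA.
  rewrite /S; set x := _ *m b; set y := _ *m c.
  by apply/matrixP => i j; rewrite !mxE; ring.
- by rewrite bC.
- by apply/matrixP => i j; rewrite !mxE; ring.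
Qed.

(** A Schur basis makes C lower triangular, with eigenvalues on the diagonal;
    solving the triangular inequality there with right-hand side P Q P* and
    transporting the solution back by congruence gives the claim. *)
Lemma stein_ineq (R : realType) (n : nat) (C Q : 'M[R[i]]_n) :
  spectrum C `&` unit_circle R = set0 -> Q \is hermsymmx ->
  exists2 M : 'M[R[i]]_n, M \is hermsymmx & Q \prec M - C ^t* *m M *m C.
Proof.
move=> C_circ hQ.
have [P uP trigT] : trigonalizable_in (@unitarymx R[i] n n) C.
  case: n C Q C_circ hQ => [|n] C Q _ _; last exact: Schur.
  exists 1%:M; last by apply/is_trig_mxP => -[].
  by apply/unitarymxP; rewrite mul1mx trmxC_scalar conjC1.
have P_unit := unitarymx_unit uP.
have PP : P ^t* *m P = 1%:M by rewrite -invmx_unitary // mulVmx.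
rewrite /similar_to /= in trigT; set T := conjmx P C in trigT.
have diagT i : `|T i i| != 1.
  apply/eqP => Ti1.
  suff : (spectrum C `&` unit_circle R) (T i i) by rewrite C_circ.
  split=> //; apply: (eigenvalue_conjmx (stablemx_unit _ P_unit)).
    by rewrite row_free_unit.
  rewrite -topredE /= eigenvalue_root_char char_poly_trig //.
  by rewrite /root horner_prod (bigD1 i) //= hornerXsubC subrr mul0r.
have [M hM pM] := stein_trig trigT diagT (hermsymmx_congr (P ^t* ) hQ).
exists (P ^t* *m M *m P); first exact: hermsymmx_congr.
move: (posdefmx_congr P_unit pM); rewrite /loewner_lt; congr posdefmx.
rewrite !(mulmxBl, mulmxBr) /T conjymx // !trmxC_mul !trmxCK !mulmxA.
by rewrite PP mul1mx -!mulmxA PP !mulmx1 mul1mx.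
Qed.

(** * Eigenvalues and the unit circle *)

(** Bridges the row-vector definition of eigenvalues and the column vectors on
    which Hermitian forms are evaluated. *)
Lemma eigenvalue_col (F : fieldType) (n : nat) (X : 'M[F]_n) (z : F) :
  eigenvalue X z -> exists2 v : 'cV_n, v != 0 & X *m v = z *: v.
Proof.
move=> /eigenvalueP [u uX u0].
have : \det (X - z%:M)^T == 0.
  rewrite det_tr; apply/det0P; exists u => //.
  by rewrite mulmxBr uX mul_mx_scalar subrr.
move=> /det0P [v v0 /(congr1 trmx)]; rewrite trmx_mul trmxK trmx0 => Xv.
exists v^T; first by rewrite trmx_eq0.
by apply/eqP; rewrite -subr_eq0 -mul_scalar_mx -mulmxBl Xv.
Qed.

(** For w = x + iy with y >= 0 the angle is acos x; for y < 0 it is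
    2 pi - acos x, which is below 2 pi because acos x = 0 would force y = 0. *)
Lemma unit_circle_cexp (R : realType) (w : R[i]) :
  `|w| = 1 ->
  exists2 theta : R, 0 <= theta < 2 * pi & cexp ('i%C * theta%:C) = w.
Proof.
have cexpE (t : R) : cexp ('i%C * t%:C) = cos t +i* sin t.
  rewrite /cexp /= !(mul0r, mul1r, mulr0, oppr0, addr0, add0r) expR0.
  by rewrite mul1r.
case: w => x y w1.
have {w1} xy1 : x ^+ 2 + y ^+ 2 = 1.
  have := add_Re2_Im2 (x +i* y); rewrite w1 expr1n /=.
  exact: complexI.
have x_itv : -1 <= x <= 1.
  rewrite -ler_norml -(@ler_sqr _ _ 1) ?nnegrE ?normr_ge0 ?ler01 //.
  by rewrite real_normK ?num_real // expr1n -xy1 lerDl sqr_ge0.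
have x_itv' : x \in `[-1, 1] by rewrite in_itv.
have sin_acosE : sin (acos x) = `|y|.
  rewrite sin_acos //; have -> : 1 - x ^+ 2 = y ^+ 2.
    by rewrite -xy1 addrC addKr.
  exact: sqrtr_sqr.
have [y_ge0|y_lt0] := leP 0 y.
  exists (acos x); last by rewrite cexpE acosK // sin_acosE ger0_norm.
  rewrite acos_ge0 //= (le_lt_trans (acos_lepi x_itv)) //.
  by rewrite mulr2n mulrDl mul1r ltrDl pi_gt0.
exists (2 * pi - acos x).
  rewrite subr_ge0 ltrBlDr ltrDl; apply/andP; split.
    by rewrite (le_trans (acos_lepi x_itv)) // mulr_natl mulr2n lerDl pi_ge0.
  rewrite lt_neqAle acos_ge0 // andbT; apply/eqP => a0.
  by move: sin_acosE; rewrite -a0 sin0 => /esym/eqP; rewrite normr_eq0 lt_eqF.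
rewrite cexpE addrC [2 * _]mulr_natl cosD2pi sinD2pi cosN sinN acosK //.
by rewrite sin_acosE ltr0_norm // opprK.
Qed.

(** With w = cexp (i theta), a row vector v satisfies v (1 + wX) = 0 exactly
    when v X = - w^-1 v, and w ranges over the whole unit circle. *)
Lemma det_cexp_spectrum (R : realType) (n : nat) (X : 'M[R[i]]_n) :
  (forall theta : R, 0 <= theta < 2 * pi ->
     \det (1%:M + cexp ('i%C * theta%:C) *: X) != 0) <->
  spectrum X `&` unit_circle R = set0.
Proof.
split=> [detX|X_circ theta _].
  rewrite -subset0 => z [/eigenvalueP [v vX v0]] /= z1.
  have z0 : z != 0 by rewrite -normr_eq0 z1 oner_eq0.
  have [|theta theta_itv w_def] := @unit_circle_cexp R (- z^-1).
    by rewrite normrN normfV z1 invr1.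
  move: (detX _ theta_itv); rewrite w_def => /det0P[]; exists v => //.
  rewrite mulmxDr mulmx1 -scalemxAr vX scalerA mulNr mulVf // scaleN1r.
  exact: subrr.
set w := cexp _.
have w1 : `|w| = 1.
  rewrite /w /cexp /= !(mul0r, mul1r, mulr0, oppr0, addr0, add0r) expR0.
  by rewrite mul1r normc_def /= cos2Dsin2 sqrtr1.
have w0 : w != 0 by rewrite -normr_eq0 w1 oner_eq0.
apply/det0P => -[v v0]; rewrite mulmxDr mulmx1 -scalemxAr => /eqP.
rewrite addrC addr_eq0 => /eqP wvX.
suff : (spectrum X `&` unit_circle R) (- w^-1) by rewrite X_circ.
split; last by rewrite /unit_circle /= normrN normfV w1 invr1.
apply/eigenvalueP; exists v => //.
by rewrite scaleNr -scalerN -wvX scalerA mulVf // scale1r.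
Qed.

(** * The equivalence *)

(** For an eigenvector v with eigenvalue z of modulus 1, the positive numbers
    (Bv)*(N - A*MA)(Bv) and v*(M - B*NB)v add up to 0, because
    A(Bv) = zv gives (Bv)*A*MA(Bv) = |z|^2 v*Mv = v*Mv. *)
Lemma spectrum_of_loewner (R : realType) (m n : nat)
    (A : 'M[R[i]]_(m, n)) (B : 'M[R[i]]_(n, m))
    (M : 'M[R[i]]_m) (N : 'M[R[i]]_n) :
  A ^t* *m M *m A \prec N -> B ^t* *m N *m B \prec M ->
  spectrum (A *m B) `&` unit_circle R = set0.
Proof.
move=> [_ AMA_N] [_ BNB_M]; rewrite -subset0 => z [/eigenvalue_col [v v0 ABv]].
move=> /= z1.
have z0 : z != 0 by rewrite -normr_eq0 z1 oner_eq0.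
have Bv0 : B *m v != 0.
  apply: contra v0 => /eqP Bv; move: ABv; rewrite -mulmxA Bv mulmx0.
  by move=> /esym/eqP; rewrite scaler_eq0 (negPf z0).
have zz : z^* * z = 1 by rewrite mulrC -normCK z1 expr1n.
have AMA : (B *m v) ^t* *m (A ^t* *m M *m A) *m (B *m v) = v ^t* *m M *m v.
  rewrite !mulmxA -trmxC_mul -!mulmxA (mulmxA A B v) ABv trmxC_scale.
  by rewrite -!scalemxAr -scalemxAl scalerA mulrC zz scale1r.
have BNB : v ^t* *m (B ^t* *m N *m B) *m v = (B *m v) ^t* *m N *m (B *m v).
  by rewrite trmxC_mul !mulmxA.
have := addr_gt0 (AMA_N _ Bv0) (BNB_M _ v0).
rewrite !mulmxBr !mulmxBl AMA BNB.
by move: (_ *m v) (_ *m (B *m v)) => x y; rewrite !mxE addrA subrK subrr ltxx.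
Qed.

(** The choice N = A*MA + 1 satisfies the first inequality trivially and turns
    the second into M - (AB)*M(AB) > B*B, a Stein inequality. *)
Lemma loewner_of_spectrum (R : realType) (m n : nat)
    (A : 'M[R[i]]_(m, n)) (B : 'M[R[i]]_(n, m)) :
  spectrum (A *m B) `&` unit_circle R = set0 ->
  exists (M : 'M[R[i]]_m) (N : 'M[R[i]]_n),
    [/\ M \is hermsymmx, N \is hermsymmx,
        A ^t* *m M *m A \prec N & B ^t* *m N *m B \prec M].
Proof.
move=> /stein_ineq /(_ (hermsymmx_gram B)) [M hM pM].
have hN : A ^t* *m M *m A + 1%:M \is hermsymmx.
  exact: hermsymmx_add (hermsymmx_congr _ hM) (hermitian1mx_subproof _).
exists M, (A ^t* *m M *m A + 1%:M); split; first exact: hM.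
- exact: hN.
- by rewrite /loewner_lt addrC addKr; exact: posdefmx1.
- move: pM; rewrite /loewner_lt; congr posdefmx.
  by rewrite trmxC_mul mulmxDr mulmxDl mulmx1 opprD addrA !mulmxA.
Qed.

Lemma block_forms (R : realType) (m n : nat)
    (A : 'M[R[i]]_(m, n)) (B : 'M[R[i]]_(n, m))
    (M : 'M[R[i]]_m) (N : 'M[R[i]]_n) (P := block_mx (- N) 0 0 M) :
  row_mx 1%:M (- A ^t* ) *m P *m col_mx 1%:M (- A) = A ^t* *m M *m A - N /\
  row_mx (B ^t* ) 1%:M *m P *m col_mx B 1%:M = M - B ^t* *m N *m B.
Proof.
rewrite /P !mul_row_block !mul_row_col !(mulmx0, mul1mx, mulmx1, addr0, add0r).
by rewrite mulNmx mulmxN mulNmx opprK mulmxN mulNmx; split; rewrite addrC.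
Qed.

Theorem mainTheorem6 (R : realType) (m n : nat)
    (A : 'M[R[i]]_(m, n)) (B : 'M[R[i]]_(n, m)) :
  [<-> (* (i) *)
       forall theta : R, 0 <= theta < 2 * pi ->
         \det (1%:M + cexp ('i%C * theta%:C) *: (A *m B)) != 0;
       (* (ii) *)
       exists (N : 'M[R[i]]_n) (M : 'M[R[i]]_m),
         [/\ N \is hermsymmx, M \is hermsymmx &
           let P : 'M[R[i]]_(n + m) := block_mx (- N) 0 0 M in
           [/\ P \is hermsymmx,
               row_mx 1%:M (- A ^t* ) *m P *m col_mx 1%:M (- A) \prec 0 &
               row_mx (B ^t* ) 1%:M *m P *m col_mx B 1%:M \succ 0]];
       (* (iii) *)
       spectrum (A *m B) `&` unit_circle R = set0;
       (* (iv) *)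
       exists (M : 'M[R[i]]_m) (N : 'M[R[i]]_n),
         [/\ M \is hermsymmx, N \is hermsymmx,
             A ^t* *m M *m A \prec N & B ^t* *m N *m B \prec M]].
Proof.
have ii_iv (M : 'M[R[i]]_m) (N : 'M[R[i]]_n) :
    let P := block_mx (- N) 0 0 M in
    (row_mx 1%:M (- A ^t* ) *m P *m col_mx 1%:M (- A) \prec 0) =
      (A ^t* *m M *m A \prec N) /\
    (row_mx (B ^t* ) 1%:M *m P *m col_mx B 1%:M \succ 0) =
      (B ^t* *m N *m B \prec M).
  have [formA formB] := block_forms A B M N.
  by rewrite /loewner_lt formA formB sub0r opprB subr0.
tfae.
- move=> /det_cexp_spectrum /loewner_of_spectrum [M [N [hM hN AMA BNB]]].
  have [eqA eqB] := ii_iv M N.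
  exists N, M; split; [exact: hN|exact: hM|rewrite /= eqA eqB; split].
  - exact: hermsymmx_block (hermsymmx_opp hN) hM.
  - exact: AMA.
  - exact: BNB.
- move=> [N [M [_ _ []]]] /= _; have [-> ->] := ii_iv M N.
  exact: spectrum_of_loewner.
- exact: loewner_of_spectrum.
- move=> [M [N [_ _ AMA BNB]]]; apply/det_cexp_spectrum.
  exact: spectrum_of_loewner AMA BNB.
Qed.
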